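(* Let $\Gamma\subset\mathbb{N}_\infty^n$ be a set such that for all $a\in\Gamma$ and all $b\in\mathbb{N}_\infty^n$ with $b\le a$ one has $b\in\Gamma$. Then the following conditions are equivalent: (a) $\Gamma=\overline{\Gamma}$; (b) for each $a\in\Gamma$ there exists $m\in\mathcal{M}(\Gamma)$ with $a\le m$.
   Context: $\mathbb{N}=\{0,1,2,\dots\}$, $\mathbb{N}_\infty=\mathbb{N}\cup\{\infty\}$; $\mathbb{N}_\infty^n$ is ordered componentwise, with $c\le\infty$ for all $c$. Every ascending sequence $a_1\le a_2\le\cdots$ in $\mathbb{N}_\infty^n$ has a limit in $\mathbb{N}_\infty^n$, taken componentwise (a non-decreasing sequence in $\mathbb{N}_\infty$ that is not eventually constant has limit $\infty$). $\overline{\Gamma}$ is the set of all $a\in\mathbb{N}_\infty^n$ which are limits of ascending sequences of elements of $\Gamma$. $\mathcal{M}(\Gamma)$ is the set of maximal elements of $\Gamma$, i.e. those $m\in\Gamma$ for which there is no $a\in\Gamma$ with $a>m$. *)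

(* Defs.v *)
From HB Require Import structures.
From mathcomp Require Import all_boot all_order.
From mathcomp Require Import boolp classical_sets filter.

Set Implicit Arguments.
Unset Strict Implicit.
Unset Printing Implicit Defensive.

Import Order.Theory.
Local Open Scope order_scope.
Local Open Scope classical_set_scope.

(* N_oo, with [None] as the point at infinity. *)
Definition natinf := option nat.
Definition ninf : natinf := None.

HB.instance Definition _ := Choice.copy natinf (option nat).

Definition le_natinf (x y : natinf) : bool :=
  match x, y with
  | _, None => true
  | None, Some _ => false
  | Some i, Some j => (i <= j)%N
  end.

Fact le_natinf_refl : reflexive le_natinf.
Proof. by case=> [i|] /=. Qed.

Fact le_natinf_anti : antisymmetric le_natinf.
Proof. by case=> [i|] [j|] //= /anti_leq ->. Qed.

Fact le_natinf_trans : transitive le_natinf.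
Proof. by case=> [j|] [i|] [k|] //=; exact: leq_trans. Qed.

Fact le_natinf_total : total le_natinf.
Proof. by case=> [i|] [j|] //=; exact: leq_total. Qed.

Fact natinf_display : Order.disp_t. Proof. by []. Qed.

HB.instance Definition _ := Order.Le_isPOrder.Build natinf_display natinf
  le_natinf_refl le_natinf_anti le_natinf_trans.

HB.instance Definition _ :=
  Order.POrder_isTotal.Build natinf_display natinf le_natinf_total.

(* N_oo^n: functions carry the pointwise order of [boolp] (see [lefP]), so
   [<=] below is componentwise and [a < b] means [a <= b] and [a != b]. *)
Notation natinfv n := ('I_n -> natinf).

(* Meant for non-decreasing [u] only. *)
Definition is_natinf_limit (u : nat -> natinf) (c : natinf) : Prop :=
  (\forall k \near \oo, u k = c) \/
  (~ (exists d, \forall k \near \oo, u k = d)) /\ c = ninf.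

Definition ascending n (a : nat -> natinfv n) : Prop :=
  forall k, a k <= a k.+1.

Definition is_limit n (a : nat -> natinfv n) (l : natinfv n) : Prop :=
  forall i, is_natinf_limit (fun k => a k i) (l i).

Definition limit_closure n (G : set (natinfv n)) : set (natinfv n) :=
  [set l | exists a : nat -> natinfv n,
     [/\ ascending a, forall k, G (a k) & is_limit a l]].

Definition maximals n (G : set (natinfv n)) : set (natinfv n) :=
  [set m | G m /\ ~ (exists2 a, G a & m < a)].

(* Main.v *)
Require Import Defs.
From mathcomp Require Import all_boot all_order.
From mathcomp Require Import boolp classical_sets.
From mathcomp Require Import filter.

(** (a) => (b): if no maximal element lies above [a], there is a strictly
    ascending sequence in [Gamma] starting at [a]; its limit lies in [Gamma]
    and has fewer finite coordinates than [a], so one concludes by induction.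

    (b) => (a): if [l] is the limit of [a_k], choose maximal [m_k >= a_k].  By
    Dickson's argument [m_k] has a non-decreasing subsequence, which is
    constant since its terms are maximal; its value bounds every [a_k], hence
    bounds [l]. *)

Set Implicit Arguments.
Unset Strict Implicit.
Unset Printing Implicit Defensive.

Import Order.Theory.
Local Open Scope order_scope.
Local Open Scope classical_set_scope.

Lemma le_ninf (x : natinf) : x <= ninf.
Proof. by case: x. Qed.

Lemma ninf_le (x : natinf) : (ninf <= x) = (x == ninf).
Proof. by case: x. Qed.

Lemma ascending_le d (T : porderType d) (u : nat -> T) :
  (forall k, u k <= u k.+1) -> {homo u : i j / (i <= j)%N >-> i <= j}.
Proof.
by move=> u_asc; apply: homo_leq => [x|x y z|//]; [exact: lexx | exact: le_trans].
Qed.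

(** Induction on the bound: either [d] already bounds [u], or some term exceeds [d], hence equals
    [d.+1], and monotonicity freezes the sequence from there on. *)
Lemma bounded_eventually_cst (u : nat -> natinf) (d : nat) :
  (forall k, u k <= u k.+1) -> (forall k, u k <= Some d) ->
  exists c, \forall k \near \oo, u k = c.
Proof.
move=> u_asc; have u_le := ascending_le u_asc.
elim: d => [|d IHd] u_bnd.
  exists (Some 0), 0 => // k _; have := u_bnd k.
  by case: (u k) => [[|i]|].
have [/IHd//|/existsNP[N uN]] := pselect (forall k, u k <= Some d).
exists (Some d.+1), N => // k /= leNk.
apply/eqP; rewrite eq_le u_bnd /=; apply: le_trans (u_le _ _ leNk).
by move: uN (u_bnd N); case: (u N) => [i|] //= /negP; rewrite -ltnNge.
Qed.

Lemma natinf_limit_exists (u : nat -> natinf) : exists c, is_natinf_limit u c.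
Proof.
have [[c uc]|ncst] := pselect (exists c, \forall k \near \oo, u k = c).
  by exists c; left.
by exists ninf; right.
Qed.

Lemma natinf_limit_ub (u : nat -> natinf) c :
  (forall k, u k <= u k.+1) -> is_natinf_limit u c -> forall k, u k <= c.
Proof.
move=> u_asc [[N _ uc]|[_ ->] k]; last exact: le_ninf.
move=> k; rewrite -(uc (maxn k N)) /=; last exact: leq_maxr.
by apply: ascending_le => //; exact: leq_maxl.
Qed.

Lemma natinf_limit_le (u : nat -> natinf) c x :
  (forall k, u k <= u k.+1) -> is_natinf_limit u c ->
  (forall k, u k <= x) -> c <= x.
Proof.
move=> u_asc [[N _ uc] u_bnd|[ncst ->] u_bnd].
  by rewrite -(uc N) //=.
(* A finite bound would make [u] eventually constant, against [ncst]. *)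
by case: x u_bnd => [d|//] /(bounded_eventually_cst u_asc).
Qed.

Lemma limit_exists n (a : nat -> natinfv n) : exists l, is_limit a l.
Proof. by have /choice[l al] i := natinf_limit_exists (fun k => a k i); exists l. Qed.

Section Limits.
Variables (n : nat) (a : nat -> natinfv n) (l : natinfv n).
Hypotheses (a_asc : ascending a) (al : is_limit a l).

Let coord_asc i k : a k i <= a k.+1 i.
Proof. by move/lefP: (a_asc k); apply. Qed.

Lemma limit_ub k : a k <= l.
Proof.
by apply/lefP => i; exact: (natinf_limit_ub (u := fun k => a k i)).
Qed.

Lemma limit_le x : (forall k, a k <= x) -> l <= x.
Proof.
move=> a_bnd; apply/lefP => i.
apply: (natinf_limit_le (u := fun k => a k i)) => // k.
by move/lefP: (a_bnd k); apply.
Qed.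

(** Otherwise every coordinate would be eventually constant; as there are finitely many of them, [a]
    itself would be eventually constant, against strictness. *)
Lemma strict_limit_new_ninf :
  (forall k, a k < a k.+1) -> exists2 i, a 0 i != ninf & l i = ninf.
Proof.
move=> a_str; apply: contrapT => no_new.
have ev_cst i : \forall k \near \oo, a k i = l i.
  (* A coordinate that is not eventually constant has limit [ninf], so without a new infinity it
     starts at [ninf]; being non-decreasing, it then stays there. *)
  have [//|[ncst li]] := al i; case: no_new; exists i => //.
  apply/negP => /eqP a0i; apply: ncst; exists ninf; near=> k.
  apply/eqP; rewrite -ninf_le -a0i.
  exact: (ascending_le (u := fun k => a k i)).
have [N _ aN] : \forall k \near \oo, forall i, a k i = l i.
  exact: filter_forall.
have aNS k : (N <= k)%N -> a k = l by move=> /aN akl; apply/funext.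
by have := a_str N; rewrite !aNS // ltxx.
Unshelve. all: by end_near.
Qed.

End Limits.

(** The measure on which the induction for (a) => (b) runs. *)
Definition nb_finite n (a : natinfv n) := #|[pred i | a i != ninf]|.

Lemma nb_finite_lt n (a l : natinfv n) i :
  a <= l -> a i != ninf -> l i = ninf -> (nb_finite l < nb_finite a)%N.
Proof.
move=> /lefP al ai li; apply: proper_card; apply/properP; split.
  apply/fintype.subsetP => j; rewrite !inE; apply: contra => /eqP aj.
  by rewrite -ninf_le -aj.
by exists i; rewrite !inE // li eqxx.
Qed.

Lemma strict_sequence n (G : set (natinfv n)) a : G a ->
  (forall b, G b -> a <= b -> exists2 c, G c & b < c) ->
  exists s : nat -> natinfv n,
    [/\ s 0 = a, forall k, G (s k) & forall k, s k < s k.+1].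
Proof.
move=> Ga step.
have /choice[f fP] b : exists c, G b -> a <= b -> G c /\ b < c.
  have [[Gb ab]|nGb] := pselect (G b /\ a <= b).
    by have [c] := step b Gb ab; exists c.
  (* Junk value, making the choice function total. *)
  by exists b => Gb ab; case: nGb.
have inv k : G (iter k f a) /\ a <= iter k f a.
  elim: k => [//|k [Gk ak]] /=.
  have [Gf /ltW kf] := fP _ Gk ak; split=> //; exact: le_trans kf.
exists (fun k => iter k f a); split=> // k; first by case: (inv k).
by have [Gk ak] := inv k; case: (fP _ Gk ak).
Qed.

Lemma closed_maximal_above n (G : set (natinfv n)) a :
  limit_closure G `<=` G -> G a -> exists2 m, maximals G m & a <= m.
Proof.
move=> G_closed; have [p] := ubnP (nb_finite a).
elim: p a => // p IHp a lt_ap Ga; apply: contrapT => no_max.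
have step b : G b -> a <= b -> exists2 c, G c & b < c.
  by move=> Gb ab; apply: contrapT => b_max; apply: no_max; exists b.
have [s [s0 Gs s_str]] := strict_sequence Ga step.
have s_asc : ascending s by move=> k; exact: ltW.
have [l sl] := limit_exists s.
have [i s0i li] := strict_limit_new_ninf s_asc sl s_str.
have al : a <= l by rewrite -s0; exact: limit_ub.
have [||m mmax lm] := IHp l.
- rewrite s0 in s0i; have := nb_finite_lt al s0i li.
  by move=> /leq_trans; apply.
- by apply: G_closed; exists s.
- by apply: no_max; exists m => //; exact: le_trans lm.
Qed.

(** Well-foundedness of the order: unless the tail is constantly infinite, its least finite value is
    attained. *)
Lemma natinf_argmin_tail (u : nat -> natinf) N :
  exists2 j, (N <= j)%N & forall k, (N <= k)%N -> u j <= u k.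
Proof.
have [all_inf|/existsNP[k0 /not_implyP[Nk0 /eqP]]] :=
    pselect (forall k, (N <= k)%N -> u k = ninf).
  by exists N => // k /all_inf ->; exact: le_ninf.
case Eu: (u k0) => [v0|//] _.
have exv : exists v, `[< exists2 k, (N <= k)%N & u k = Some v >].
  by exists v0; apply/asboolP; exists k0.
case: (ex_minnP exv) => v /asboolP[j Nj uj] v_min; exists j => // k Nk.
rewrite uj; case Ek: (u k) => [w|//].
by apply: v_min; apply/asboolP; exists k.
Qed.

(** Each new index minimises [u] over the tail strictly after the previous one; minima over
    shrinking tails can only grow. *)
Lemma natinf_ascending_subseq (u : nat -> natinf) :
  exists2 phi : nat -> nat, (forall k, (phi k < phi k.+1)%N)
    & forall k, u (phi k) <= u (phi k.+1).
Proof.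
have /choice[f fP] N :
    exists j, (N <= j)%N /\ forall k, (N <= k)%N -> u j <= u k.
  by have [j] := natinf_argmin_tail u N; exists j.
pose phi k := iter k (fun x => f x.+1) (f 0).
have phiS k : (phi k < phi k.+1)%N by exact: (fP _).1.
exists phi => // -[|k]; first exact: (fP 0).2.
by apply: (fP (phi k).+1).2; apply: ltn_trans (phiS k.+1); exact: phiS.
Qed.

Lemma ascending_subseq n (u : nat -> natinfv n) :
  exists2 phi : nat -> nat, (forall k, (phi k < phi k.+1)%N)
    & ascending (u \o phi).
Proof.
(* Generalised to a list of coordinates: each induction step refines the subsequence for one more
   coordinate, and refining keeps the others non-decreasing. *)
suff [phi phiS uphi] : exists2 phi : nat -> nat,
    (forall k, (phi k < phi k.+1)%N)
    & forall i, i \in enum 'I_n -> forall k, u (phi k) i <= u (phi k.+1) i.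
  by exists phi => // k; apply/lefP => i; apply: uphi; rewrite mem_enum.
elim: (enum 'I_n) => [|i s [phi phiS uphi]]; first by exists id.
have [psi psiS upsi] := natinf_ascending_subseq (fun k => u (phi k) i).
have phi_lt : {homo phi : x y / (x < y)%N}.
  exact: homo_ltn ltn_trans phiS.
exists (phi \o psi) => [k|j]; first exact: phi_lt.
rewrite inE => /predU1P[->//|js] k.
apply: (ascending_le (u := fun k => u (phi k) j)) (ltnW (psiS k)).
exact: uphi.
Qed.

Lemma maximals_above_closed n (G : set (natinfv n)) :
  (forall a b : natinfv n, G a -> b <= a -> G b) ->
  (forall a, G a -> exists2 m, maximals G m & a <= m) ->
  limit_closure G `<=` G.
Proof.
move=> G_down G_max l [a [a_asc Ga al]].
have /choice[m mP] k : exists m, maximals G m /\ a k <= m.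
  by have [m] := G_max _ (Ga k); exists m.
have [phi phiS m_asc] := ascending_subseq m.
have m_cst k : m (phi k) = m (phi 0).
  elim: k => [//|k <-]; apply/eqP; rewrite eq_sym; apply/negP => /negP neq.
  have [[_ m_max] _] := mP (phi k); apply: m_max.
  exists (m (phi k.+1)); first by have [[]] := mP (phi k.+1).
  by rewrite lt_neqAle neq; exact: m_asc.
(* This gives [a k <= a (phi k) <= m (phi k)], so the constant value [m (phi 0)] bounds the whole
   sequence and not just a subsequence. *)
have phi_ge k : (k <= phi k)%N.
  by elim: k => // k IHk; exact: leq_ltn_trans (phiS k).
(* By downward closure it suffices to bound [l] by an element of [G]. *)
apply: (G_down (m (phi 0))); first by have [[]] := mP (phi 0).
apply: (limit_le a_asc al) => k; rewrite -(m_cst k).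
exact: le_trans (ascending_le a_asc (phi_ge k)) (mP (phi k)).2.
Qed.

Lemma sub_limit_closure n (G : set (natinfv n)) : G `<=` limit_closure G.
Proof.
move=> a Ga; exists (fun=> a); split=> // i.
by left; exists 0.
Qed.

Theorem lemma9p3 (n : nat) (Gamma : set (natinfv n))
  (Gamma_down : forall a b : natinfv n, Gamma a -> (b <= a)%O -> Gamma b) :
  Gamma = limit_closure Gamma <->
  (forall a : natinfv n, Gamma a -> exists2 m, maximals Gamma m & (a <= m)%O).
Proof.
split=> [eqG a|G_max].
  by apply: closed_maximal_above; rewrite -eqG.
apply/seteqP; split; first exact: sub_limit_closure.
exact: maximals_above_closed.
Qed.
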